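(* Let $(A,\circ_A)$ be a mock-Lie algebra with an action $(B,\pi,\circ_B)$ on a mock-Lie algebra $(B,\circ_B)$, and let $\mathcal{H}:B\to A$ be a homomorphic embedding tensor. Then $(B,\{\cdot,\cdot\}_{\mathcal{H}},\circ_B)$ is an anti-Leibniz trialgebra, where $$\{a,b\}_{\mathcal{H}}=\pi(\mathcal{H}(a))b,\qquad \forall a,b\in B.$$
   Context: All vector spaces and algebras are finite dimensional over a field $\mathbb{K}$ of characteristic zero. A mock-Lie algebra $(A,\circ)$ is a vector space with a commutative bilinear product satisfying $x\circ(y\circ z)+y\circ(z\circ x)+z\circ(x\circ y)=0$. A representation of $(A,\circ)$ on $V$ is a linear map $\pi:A\to\mathrm{End}(V)$ with $\pi(x\circ y)=-\pi(x)\pi(y)-\pi(y)\pi(x)$. For mock-Lie algebras $(A,\circ_A)$, $(B,\circ_B)$, an action of $A$ on $B$, denoted $(B,\pi,\circ_B)$, is a linear map $\pi:A\to\mathrm{End}(B)$ such that $(B,\pi)$ is a representation of $A$ and $\pi(x)(a\circ_B b)+a\circ_B\pi(x)b+b\circ_B\pi(x)a=0$ for all $x\in A$, $a,b\in B$. A homomorphic embedding tensor is a linear map $\mathcal{H}:B\to A$ which is both an embedding tensor, i.e. $\mathcal{H}(a)\circ_A\mathcal{H}(b)=\mathcal{H}(\pi(\mathcal{H}(a))b)$, and a morphism, i.e. $\mathcal{H}(a\circ_B b)=\mathcal{H}(a)\circ_A\mathcal{H}(b)$, for all $a,b\in B$. An anti-Leibniz algebra is a vector space with a bilinear bracket satisfying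 $\{x,\{y,z\}\}=-\{\{x,y\},z\}-\{y,\{x,z\}\}$. An anti-Leibniz trialgebra is a triple $(L,\{\cdot,\cdot\},\circ)$ with $(L,\circ)$ a mock-Lie algebra and $(L,\{\cdot,\cdot\})$ an anti-Leibniz algebra such that $\{x,y\circ z\}+y\circ\{x,z\}+z\circ\{x,y\}=0$ and $\{x\circ y,z\}=\{\{x,y\},z\}$ for all $x,y,z\in L$. *)

(* Defs.v *)
From mathcomp Require Import all_boot all_algebra.

Set Implicit Arguments.
Unset Strict Implicit.
Unset Printing Implicit Defensive.

Import GRing.Theory.
Local Open Scope ring_scope.

Record mock_Lie (K : fieldType) (A : vectType K) (mul : A -> A -> A) : Prop :=
  MockLie {
    mock_Lie_bilinear : bilinear_for *:%R *:%R mul;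
    mock_Lie_comm : forall x y, mul x y = mul y x;
    mock_Lie_jacobi : forall x y z,
      mul x (mul y z) + mul y (mul z x) + mul z (mul x y) = 0 }.

Record anti_Leibniz (K : fieldType) (L : vectType K) (br : L -> L -> L) : Prop :=
  AntiLeibniz {
    anti_Leibniz_bilinear : bilinear_for *:%R *:%R br;
    anti_Leibniz_identity : forall x y z,
      br x (br y z) = - br (br x y) z - br y (br x z) }.

Record anti_Leibniz_trialgebra (K : fieldType) (L : vectType K)
    (br mul : L -> L -> L) : Prop := AntiLeibnizTrialgebra {
  trialgebra_mock_Lie : mock_Lie mul;
  trialgebra_anti_Leibniz : anti_Leibniz br;
  trialgebra_br_mulr : forall x y z,
    br x (mul y z) + mul y (br x z) + mul z (br x y) = 0;
  trialgebra_br_mull : forall x y z, br (mul x y) z = br (br x y) z }.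

(* [(f \o g)%VF v = f (g v)], the product of End(V). *)
Definition representation (K : fieldType) (A V : vectType K)
    (mulA : A -> A -> A) (pi : 'Hom(A, 'End(V))) : Prop :=
  forall x y, pi (mulA x y) = - (pi x \o pi y)%VF - (pi y \o pi x)%VF.

Record action (K : fieldType) (A B : vectType K) (mulA : A -> A -> A)
    (mulB : B -> B -> B) (pi : 'Hom(A, 'End(B))) : Prop := Action {
  action_representation : representation mulA pi;
  action_mul : forall x a b,
    pi x (mulB a b) + mulB a (pi x b) + mulB b (pi x a) = 0 }.

Definition embedding_tensor (K : fieldType) (A V : vectType K)
    (mulA : A -> A -> A) (pi : 'Hom(A, 'End(V))) (H : 'Hom(V, A)) : Prop :=
  forall u v, mulA (H u) (H v) = H (pi (H u) v).

Record homomorphic_embedding_tensor (K : fieldType) (A B : vectType K)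
    (mulA : A -> A -> A) (mulB : B -> B -> B) (pi : 'Hom(A, 'End(B)))
    (H : 'Hom(B, A)) : Prop := HomomorphicEmbeddingTensor {
  homomorphic_embedding : embedding_tensor mulA pi H;
  homomorphic_morphism : forall a b, H (mulB a b) = mulA (H a) (H b) }.

Definition descendent_bracket (K : fieldType) (A V : vectType K)
    (pi : 'Hom(A, 'End(V))) (H : 'Hom(V, A)) (a b : V) : V := pi (H a) b.

(* Main.v *)
Require Import Defs.
From mathcomp Require Import all_boot all_algebra.

Import GRing.Theory.
Local Open Scope ring_scope.

(** Write [{a, b}] for [pi (H a) b].  The embedding tensor condition says that
    [H] sends this bracket to the product of [A], so
    [{{a, b}, c} = pi (H a * H b) c]: a nested bracket on the left is the action
    of a product.  The identities to prove then reduce to hypotheses.  The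
    representation identity, evaluated at [c], expands [pi (H a * H b) c] as
    [- {a, {b, c}} - {b, {a, c}}], which is the anti-Leibniz identity solved for
    its middle term.  The compatibility of [{a, -}] with the product of [B] is
    the action axiom for the element [H a].  Finally, [H] being a morphism,
    [{a * b, c}] is also [pi (H a * H b) c], hence equals [{{a, b}, c}]. *)

Lemma descendent_bracket_bilinear (K : fieldType) (A V : vectType K)
    (pi : 'Hom(A, 'End(V))) (H : 'Hom(V, A)) :
  bilinear_for *:%R *:%R (descendent_bracket pi H).
Proof.
split=> u k x y; rewrite /descendent_bracket; last exact: linearP.
by rewrite !linearP /= add_lfunE scale_lfunE.
Qed.

(** Rewriting the left-nested bracket as the action of a product in [A] lets the
    representation identity expand it; the two terms [{y, {x, z}}] cancel. *)
Lemma descendent_anti_Leibniz (K : fieldType) (A V : vectType K)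
    (mulA : A -> A -> A) (pi : 'Hom(A, 'End(V))) (H : 'Hom(V, A)) :
  representation mulA pi -> embedding_tensor mulA pi H ->
  anti_Leibniz (descendent_bracket pi H).
Proof.
move=> repr embH; split=> [|x y z]; first exact: descendent_bracket_bilinear.
rewrite /descendent_bracket -embH repr.
by rewrite add_lfunE !opp_lfunE !comp_lfunE opprD !opprK addrK.
Qed.

Theorem theorem4p3 (K : fieldType) (charK0 : [pchar K] =i pred0)
    (A B : vectType K) (mulA : A -> A -> A) (mulB : B -> B -> B)
    (pi : 'Hom(A, 'End(B))) (H : 'Hom(B, A))
    (mockA : mock_Lie mulA) (mockB : mock_Lie mulB)
    (actAB : action mulA mulB pi)
    (homH : homomorphic_embedding_tensor mulA mulB pi H) :
  anti_Leibniz_trialgebra (descendent_bracket pi H) mulB.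
Proof.
case: actAB homH => repr actM [embH morH]; split=> // [|x y z|x y z].
- exact: descendent_anti_Leibniz repr embH.
- exact: actM.
- by rewrite /descendent_bracket morH embH.
Qed.
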